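(* Let $M$ be a complete pointed metric space and $k\in\mathbb N$. If a sequence $(\gamma_n)_n\subset\mathcal{FS}_k(M)$ converges weakly to some $\gamma\in\mathcal F(M)$, then $\gamma\in\mathcal{FS}_k(M)$ and $(\gamma_n)_n$ converges to $\gamma$ in norm.
   Context: Scalars are $\mathbb K=\mathbb R$ or $\mathbb C$. For a pointed metric space $(M,d,0_M)$, $\mathrm{Lip}_0(M)$ denotes the Banach space of Lipschitz functions $g\colon M\to\mathbb K$ with $g(0_M)=0$ normed by the best Lipschitz constant; $\delta(x)\in\mathrm{Lip}_0(M)^*$ is evaluation at $x$; the Lipschitz-free space $\mathcal F(M)$ is the norm-closed linear span of $\{\delta(x):x\in M\}$ in $\mathrm{Lip}_0(M)^*$, and its dual is $\mathrm{Lip}_0(M)$. For a closed $K\subset M$ with $0_M\in K$, $\mathcal F(K)$ is identified with the closed span of $\{\delta(x):x\in K\}$ in $\mathcal F(M)$. The support $\mathrm{supp}(\gamma)$ of $\gamma\in\mathcal F(M)$ is the smallest closed $K\subset M$ with $\gamma\in\mathcal F(K)$. $\mathcal{FS}_k(M)$ is the set of $\gamma\in\mathcal F(M)$ whose support is finite with at most $k$ points; equivalently $\gamma=\sum_{i=1}^k a_i\delta(x_i)$ with $a_i\in\mathbb K$, $x_i\in M$. *)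

(* Defs.v *)
From HB Require Import structures.
From mathcomp Require Import all_boot all_order all_algebra.
From mathcomp Require Import complex.
From mathcomp Require Import reals.
Set Implicit Arguments. Unset Strict Implicit. Unset Printing Implicit Defensive.
Import Order.TTheory GRing.Theory Num.Theory.
Local Open Scope ring_scope.

Definition is_metric (R : realType) (M : Type) (d : M -> M -> R) : Prop :=
  (forall x y, d x y = 0 <-> x = y) /\
  (forall x y, d x y = d y x) /\
  (forall x y z, d x z <= d x y + d y z).

Definition complete_metric (R : realType) (M : Type) (d : M -> M -> R) : Prop :=
  forall u : nat -> M,
    (forall e, 0 < e -> exists N, forall m n, (N <= m)%N -> (N <= n)%N -> d (u m) (u n) < e) ->
    exists l, forall e, 0 < e -> exists N, forall n, (N <= n)%N -> d (u n) l < e.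

(* ---------- Lipschitz-free spaces ----------
   Scalars: a field K with absolute value nrm : K -> R
   (K = R with the usual absolute value, or K = R[i] with the modulus).
   Elements of Lip_0(M)^* are represented by functions (M -> K) -> K; only
   their values on Lip_0(M) matter. *)
Section Free.
Variables (R : realType) (K : fieldType) (nrm : K -> R).
Variables (M : Type) (d : M -> M -> R) (x0 : M).

Definition lipconst (g : M -> K) (L : R) : Prop :=
  0 <= L /\ forall x y, nrm (g x - g y) <= L * d x y.

Definition Lip0 (g : M -> K) : Prop := g x0 = 0 /\ exists L, lipconst g L.

(* || phi ||_{Lip_0(M)^*} <= e  (the norm of g is its best Lipschitz constant,
   i.e. the least L with lipconst g L; the inequality below for all such L
   is exactly |phi g| <= e ||g||_Lip for all g) *)
Definition opnorm_le (phi : (M -> K) -> K) (e : R) : Prop :=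
  forall g L, g x0 = 0 -> lipconst g L -> nrm (phi g) <= e * L.

Definition dual_elem (phi : (M -> K) -> K) : Prop :=
  (forall (a : K) g h, Lip0 g -> Lip0 h ->
      phi (fun x => a * g x + h x) = a * phi g + phi h) /\
  exists C, opnorm_le phi C.

Definition delta (x : M) : (M -> K) -> K := fun g => g x.

Definition in_span_delta (phi : (M -> K) -> K) : Prop :=
  exists (n : nat) (a : 'I_n -> K) (xs : 'I_n -> M),
    forall g, Lip0 g -> phi g = \sum_(i < n) a i * delta (xs i) g.

Definition in_Free (phi : (M -> K) -> K) : Prop :=
  dual_elem phi /\
  forall e, 0 < e -> exists psi, in_span_delta psi /\
     opnorm_le (fun g => phi g - psi g) e.

Definition in_FS (k : nat) (phi : (M -> K) -> K) : Prop :=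
  exists (a : 'I_k -> K) (xs : 'I_k -> M),
    forall g, Lip0 g -> phi g = \sum_(i < k) a i * delta (xs i) g.

Definition Free_dual_elem (Phi : ((M -> K) -> K) -> K) : Prop :=
  (forall (a : K) phi psi, in_Free phi -> in_Free psi ->
      Phi (fun g => a * phi g + psi g) = a * Phi phi + Phi psi) /\
  exists C, 0 <= C /\ forall phi e, in_Free phi -> opnorm_le phi e -> nrm (Phi phi) <= C * e.

Definition weak_cvg (gs : nat -> (M -> K) -> K) (gam : (M -> K) -> K) : Prop :=
  forall Phi, Free_dual_elem Phi ->
    forall e, 0 < e -> exists N, forall n, (N <= n)%N -> nrm (Phi (gs n) - Phi gam) < e.

Definition norm_cvg (gs : nat -> (M -> K) -> K) (gam : (M -> K) -> K) : Prop :=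
  forall e, 0 < e -> exists N, forall n, (N <= n)%N ->
    opnorm_le (fun g => gs n g - gam g) e.

End Free.

Definition cmod (R : realType) (z : R[i]) : R := Normc.normc z.

(* Main.v *)
(** Testing against real-valued 1-Lipschitz functions is enough.  Write an
    element of FS_k as [sum_i a_i delta(y_i)] with total mass 0 (adding the base
    point).  Slicing a 1-Lipschitz f along its values shows that if the norm
    exceeds [#|I| c] then some set A of indices satisfies [|a(A)| s > c], where
    s bounds from below the distances between the points of A and the others.

    Suppose a weakly null sequence of such elements is bounded away from 0 in
    norm, and fix such sets A_n with separations s_n along an ultrafilter.
    - If s_n -> 0, any 1-Lipschitz function can be perturbed by O(s_n), without
      increasing its Lipschitz constant, so that the n-th element sees it.
    - If s_n -> oo, or if the part of A_n escaping every finite set carries mass,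
      tents on A_n can be added to any previous function of the same kind.
    - Otherwise mass stays near finitely many points, where one test function
      detects it.
    The first two cases are closed by a gliding hump.  Applied to differences of
    a weakly convergent sequence, this gives norm convergence.  Finally the limit
    annihilates every Lipschitz function vanishing at the limits of the
    non-escaping points, hence is a combination of the evaluations there. *)

Require Import Defs.
From HB Require Import structures.
From mathcomp Require Import all_boot all_order all_algebra.
From mathcomp Require Import complex.
From mathcomp Require Import reals.
From mathcomp Require Import boolp classical_sets filter.
From mathcomp Require Import ring lra.
Import Order.TTheory GRing.Theory Num.Theory.
Local Open Scope ring_scope.
Set Implicit Arguments. Unset Strict Implicit. Unset Printing Implicit Defensive.

(** * Functions with Lipschitz constant one *)

Section LipschitzOne.
Variables (R : realType) (M : Type) (d : M -> M -> R).
Hypothesis hd : is_metric d.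

Lemma dist_sym x y : d x y = d y x.
Proof. by case: hd => _ []. Qed.

Lemma dist_tri y x z : d x z <= d x y + d y z.
Proof. by case: hd => _ []. Qed.

Lemma dist_self x : d x x = 0.
Proof. by case: hd => h _; apply/h. Qed.

Lemma dist_ge0 x y : 0 <= d x y.
Proof. have := dist_tri y x x; rewrite dist_self (dist_sym y x); lra. Qed.

Definition lip1 (f : M -> R) := forall x y, f x - f y <= d x y.

Lemma lip1_abs f x y : lip1 f -> `|f x - f y| <= d x y.
Proof.
move=> lf; rewrite ler_norml; have := lf x y; have := lf y x.
by rewrite (dist_sym y x); lra.
Qed.

Lemma lip1_cst c : lip1 (fun=> c).
Proof. by move=> x y; rewrite subrr dist_ge0. Qed.

Lemma lip1_dist c p : lip1 (fun x => c - d x p).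
Proof. move=> x y; have := dist_tri x y p; rewrite (dist_sym y x); lra. Qed.

Lemma lip1_max f g : lip1 f -> lip1 g -> lip1 (fun x => Num.max (f x) (g x)).
Proof.
move=> lf lg x y; have := lf x y; have := lg x y.
by case: (leP (f x) (g x)); case: (leP (f y) (g y)); lra.
Qed.

Lemma lip1_min f g : lip1 f -> lip1 g -> lip1 (fun x => Num.min (f x) (g x)).
Proof.
move=> lf lg x y; have := lf x y; have := lg x y.
by case: (leP (f x) (g x)); case: (leP (f y) (g y)); lra.
Qed.

Lemma lip1_shift f c : lip1 f -> lip1 (fun x => f x + c).
Proof. by move=> lf x y; have := lf x y; lra. Qed.

Lemma lip1_bigmax (I : finType) (P : pred I) (F : I -> M -> R) g :
  lip1 g -> (forall i, lip1 (F i)) ->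
  lip1 (fun x => \big[Num.max/g x]_(i | P i) F i x).
Proof.
move=> lg lF x y; rewrite lerBlDr; apply/bigmax_leP; split.
  have := lg x y; have := bigmax_ge_id (index_enum I) (g y) P (F ^~ y); lra.
move=> i Pi; have := lF i x y.
by have := @le_bigmax_cond _ _ _ (g y) i P (F ^~ y) Pi; lra.
Qed.

Definition tent (I : finType) (A : {set I}) (y : I -> M) (h : R) (x : M) : R :=
  \big[Num.max/0]_(i in A) (h - d x (y i)).

Section Tent.
Variables (I : finType) (A : {set I}) (y : I -> M) (h : R).

Lemma tent_lip1 : lip1 (tent A y h).
Proof. apply: lip1_bigmax; [exact: lip1_cst|move=> i; exact: lip1_dist]. Qed.

Lemma tent_ge0 x : 0 <= tent A y h x.
Proof. exact: bigmax_ge_id. Qed.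

Lemma tent_ge i x : i \in A -> h - d x (y i) <= tent A y h x.
Proof. exact: (@le_bigmax_cond _ _ _ 0 i _ (fun i => h - d x (y i))). Qed.

Lemma tent_le x : 0 <= h -> tent A y h x <= h.
Proof.
by move=> h0; apply/bigmax_leP; split=> // i _; have := dist_ge0 x (y i); lra.
Qed.

Lemma tent_center i : 0 <= h -> i \in A -> tent A y h (y i) = h.
Proof.
move=> h0 iA; apply/eqP; rewrite eq_le tent_le //=.
by have := tent_ge (y i) iA; rewrite dist_self subr0.
Qed.

Lemma tent_far x : (forall i, i \in A -> h <= d x (y i)) -> tent A y h x = 0.
Proof.
move=> far; apply/eqP; rewrite eq_le tent_ge0 andbT.
by apply/bigmax_leP; split=> // i iA; have := far i iA; lra.
Qed.

End Tent.

Lemma max0_bound (u v w : R) : u - Num.max 0 v <= w -> (u <= w) || (u - v <= w).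
Proof. by case: (leP 0 v) => _ h; apply/orP; [right|left]; lra. Qed.

(* With c = f p, the map t |-> max t (min c (t + s)) collapses [c - s, c] to c
   and translates by s everything below. *)
Lemma collapse_below (c s e t t' : R) : 0 <= s -> 0 <= e -> t - e <= t' ->
  Num.max t (Num.min c (t + s)) - e <= Num.max t' (Num.min c (t' + s)).
Proof.
move=> s0 e0 h; have h1 : t' <= Num.max t' (Num.min c (t' + s)).
  by rewrite le_max lexx.
have h2 : Num.min c (t' + s) <= Num.max t' (Num.min c (t' + s)).
  by rewrite le_max lexx orbT.
rewrite lerBlDr ge_max; apply/andP; split; first lra.
have h3 : Num.min c (t + s) <= c by rewrite ge_min lexx.
have h4 : Num.min c (t + s) <= t + s by rewrite ge_min lexx orbT.
by move: h2; case: (leP c (t' + s)) => _ h2; lra.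
Qed.

(** One collapse per point [p] of [l], with [c] the value at [p], keeps [g] from dipping below [g p]
    within distance [s] of [p]. Collapsing is monotone and nonexpansive, so later collapses keep
    what earlier ones gained. *)
Lemma flatten_at (f : M -> R) (s : R) (l : seq M) : lip1 f -> 0 <= s ->
  exists g, [/\ lip1 g, forall x, f x <= g x <= f x + s *+ size l &
    forall j x0 x, (j < size l)%N ->
      g (nth x0 l j) - Num.max 0 (d x (nth x0 l j) - s) <= g x].
Proof.
move=> lf s0; elim: l => [|p l [g [lg gf gl]]].
  by exists f; split=> // x; rewrite mulr0n addr0 lexx.
exists (fun x => Num.max (g x) (Num.min (g p) (g x + s))); split.
- apply: lip1_max => //; apply: lip1_min; [exact: lip1_cst|exact: lip1_shift].
- move=> x; have /andP[] := gf x; rewrite /= mulrSr addrA => g1 g2.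
  case: (leP (g p) (g x + s)) => ?; rewrite /Num.max; case: ifPn => ?; lra.
- move=> [|j] x0 x jl /=; last first.
    by apply: collapse_below => //; [rewrite le_max lexx|exact: gl].
  have {gf gl} := lg p x; rewrite (dist_sym p x) => h.
  have -> : Num.max (g p) (Num.min (g p) (g p + s)) = g p.
    by rewrite minEle lerDl s0 maxxx.
  rewrite le_max; case: (leP 0 (d x p - s)) => ?; last first.
    by rewrite subr0 le_min lexx /=; apply/orP; right; lra.
  by rewrite le_min; apply/orP; right; apply/andP; split; lra.
Qed.

(** Flattening makes room for cones of height [s]: both functions stay near [f], yet a combination
    sees them differ by [s] times its mass on [A], so it cannot be small on both when that product
    is large. *)
Lemma raise_on (I : finType) (A : {set I}) (y : I -> M) (s : R) (f : M -> R) :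
  lip1 f -> 0 <= s ->
  (forall i l, i \in A -> l \notin A -> s <= d (y i) (y l)) ->
  exists g g', [/\ lip1 g, lip1 g',
    forall x, f x <= g x <= g' x /\ g' x <= f x + s *+ #|I|.+1 &
    forall i, g' (y i) = g (y i) + (if i \in A then s else 0)].
Proof.
move=> lf s0 sep.
have [g [lg gf gl]] := flatten_at (map y (enum I)) lf s0.
have {}gl i x : g (y i) - Num.max 0 (d x (y i) - s) <= g x.
  have il : (index i (enum I) < size (enum I))%N by rewrite index_mem mem_enum.
  have := gl (index i (enum I)) (y i) x; rewrite size_map (nth_map i) //.
  by rewrite nth_index ?mem_enum //; apply.
(* Cones with apex [s] above [g]: after flattening they exceed [g] by at most [s], and not at all at
   distance [s] or more from their centre. *)
pose u i x := (g (y i) + s) - d x (y i).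
pose g' x := \big[Num.max/g x]_(i in A) u i x.
have ug i x : u i x <= g x + s.
  rewrite /u; have := dist_ge0 x (y i).
  by have /max0_bound/orP[] := gl i x; lra.
have gg' x : g x <= g' x by exact: bigmax_ge_id.
exists g, g'; split=> //.
- by apply: lip1_bigmax => // i; exact: lip1_dist.
- move=> x; have /andP[g1 g2] := gf x.
  rewrite g1 gg' mulrSr addrA; split=> //.
  move: g2; rewrite size_map -cardE => g2.
  suff : g' x <= g x + s by lra.
  by apply/bigmax_leP; split=> //; lra.
- move=> i; apply/eqP; rewrite eq_le; case: ifPn => iA; apply/andP; split.
  + by apply/bigmax_leP; split=> [|j jA]; [lra|exact: ug].
  + have := @le_bigmax_cond _ _ _ (g (y i)) i (mem A) (u ^~ (y i)) iA.
    by rewrite /u dist_self subr0.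
  + rewrite addr0; apply/bigmax_leP; split=> // j jA.
    have := sep j i jA iA; rewrite /u (dist_sym (y j)).
    by have /max0_bound/orP[] := gl j (y i); lra.
  + by rewrite addr0.
Qed.

End LipschitzOne.

(** * Scalars and evaluations *)

(* A common interface for the real and the complex scalars: every scalar is
   [re x + sc_unit * im x], where [sc_unit] is 0 over the reals and i over the
   complex numbers. *)
Record scalars (R : realType) (K : fieldType) (nrm : K -> R) := Scalars {
  sc_emb : {rmorphism R -> K};
  sc_unit : K;
  sc_re : K -> R;
  sc_im : K -> R;
  sc_nrmM : forall x y, nrm (x * y) = nrm x * nrm y;
  sc_nrmD : forall x y, nrm (x + y) <= nrm x + nrm y;
  sc_nrm_emb : forall r, nrm (sc_emb r) = `|r|;
  sc_nrm_unit : nrm sc_unit <= 1;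
  sc_decomp : forall x, x = sc_unit * sc_emb (sc_im x) + sc_emb (sc_re x);
  sc_reB : forall x y, sc_re (x - y) = sc_re x - sc_re y;
  sc_imB : forall x y, sc_im (x - y) = sc_im x - sc_im y;
  sc_re_le : forall x, `|sc_re x| <= nrm x;
  sc_im_le : forall x, `|sc_im x| <= nrm x }.

Section Scalars.
Variables (R : realType) (K : fieldType) (nrm : K -> R) (S : scalars nrm).
Local Notation iota := (sc_emb S).

Lemma nrm0 : nrm 0 = 0.
Proof. by rewrite -(rmorph0 iota) (sc_nrm_emb S) normr0. Qed.

Lemma nrmN x : nrm (- x) = nrm x.
Proof.
rewrite -mulN1r (sc_nrmM S) -(rmorph1 iota) -rmorphN (sc_nrm_emb S).
by rewrite normrN1 mul1r.
Qed.

Lemma nrm_ge0 x : 0 <= nrm x.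
Proof. by have := sc_nrmD S x (- x); rewrite subrr nrm0 nrmN; lra. Qed.

Lemma nrmB x y : nrm (x - y) <= nrm x + nrm y.
Proof. by rewrite -(nrmN y) (sc_nrmD S). Qed.

Lemma nrm_distC x y : nrm (x - y) = nrm (y - x).
Proof. by rewrite -nrmN opprB. Qed.

Lemma nrm_sum (I : finType) (P : pred I) (F : I -> K) :
  nrm (\sum_(i | P i) F i) <= \sum_(i | P i) nrm (F i).
Proof.
elim/big_ind2 : _ => [|x a y b xa yb|//]; first by rewrite nrm0.
by apply: le_trans (sc_nrmD S _ _) _; exact: lerD.
Qed.

(** Definiteness is not a field of [scalars]; it follows from the bounds on [sc_re] and [sc_im]
    through [sc_decomp]. *)
Lemma nrm_eq0 x : (forall e : R, 0 < e -> nrm x <= e) -> x = 0.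
Proof.
move=> h; have x0 : nrm x = 0.
  apply/eqP; rewrite eq_le nrm_ge0 andbT; apply/ler_addgt0Pl => e e0.
  by rewrite addr0 h.
have := sc_re_le S x; have := sc_im_le S x; rewrite x0 !normr_le0.
by move=> /eqP ix /eqP rx; rewrite (sc_decomp S x) ix rx !rmorph0 mulr0 addr0.
Qed.

(** * Slicing a combination of total mass zero by levels *)

Section LayerCake.
Variables (I : finType) (a : I -> K).
Hypothesis suma : \sum_i a i = 0.

Lemma sum_compl (P : pred I) : \sum_(i | P i) a i = - \sum_(i | ~~ P i) a i.
Proof. by apply/eqP; move: suma; rewrite (bigID P) /= => /eqP; rewrite addr_eq0. Qed.

Lemma sum_const_eq0 (g : I -> R) : (forall i j, g i <= g j) ->
  \sum_i a i * iota (g i) = 0.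
Proof.
move=> cst; have [i _|I0] := pickP (fun _ : I => true); last by rewrite big_pred0.
rewrite (eq_bigr (fun j => a j * iota (g i))) -?mulr_suml ?suma ?mul0r //.
by move=> j _; congr (_ * iota _); apply/eqP; rewrite eq_le !cst.
Qed.

(* Raising the least value of g to the next one removes one layer. *)
Lemma layer_cake_rec (c : R) n (g : I -> R) : 0 <= c ->
  (#|[set i | [exists l, (g l < g i)%R]]| <= n)%N ->
  c *+ n < nrm (\sum_i a i * iota (g i)) ->
  exists t s, [/\ t < s, forall i, g i <= t \/ s <= g i &
    c < nrm (\sum_(i | s <= g i) a i) * (s - t)].
Proof.
move=> c0; elim: n g => [|n IH] g card_n big;
  have [/existsP[i /existsP[l lti]]|none] :=
    boolP [exists i, [exists l, (g l < g i)%R]].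
2,4: move: big; rewrite sum_const_eq0 ?nrm0; first
  by rewrite ltNge mulrn_wge0.
2,3: by move=> i j; move: none => /existsPn/(_ i)/existsPn/(_ j); rewrite -leNgt.
  move: card_n; rewrite leqn0 cards_eq0 => /eqP/setP/(_ i).
  by rewrite !inE => /existsP[]; exists l.
case: (@arg_minP _ _ _ l predT g) => // l0 _ minl.
have l0i : g l0 < g i by apply: le_lt_trans lti; apply: minl.
case: (@arg_minP _ _ _ i (fun j => g l0 < g j) g) => // i1 l0i1 mini.
pose t := g l0; pose s := g i1.
have gap j : g j <= t \/ s <= g j.
  by case: (leP (g j) t) => h; [left|right=> //; exact: mini].
have [big1|] := ltP c (nrm (\sum_(j | s <= g j) a j) * (s - t)).
  by exists t, s.
move=> small; pose g' j := Num.max (g j) s.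
(* The indices at the lowest level [t] carry minus the mass of those above, so lifting them to [s]
   subtracts one layer. *)
have eqS : \sum_j a j * iota (g' j) =
    \sum_j a j * iota (g j) - (\sum_(j | s <= g j) a j) * iota (s - t).
  apply/eqP; rewrite eq_sym subr_eq; apply/eqP.
  rewrite sum_compl mulNr; apply/eqP; rewrite -subr_eq opprK eq_sym; apply/eqP.
  rewrite [X in _ + X * _]big_mkcond mulr_suml -big_split; apply: eq_bigr => j _ /=.
  rewrite /g'; case: (gap j) => h.
    have gt : g j = t by apply/eqP; rewrite eq_le h /=; exact: minl.
    have ns : ~~ (s <= g j) by rewrite gt -ltNge.
    rewrite ns max_r; last by rewrite gt ltW.
    by rewrite -mulrDr gt -rmorphD; congr (_ * iota _); lra.
  by rewrite h /= mul0r addr0 max_l.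
case: (IH g') => //.
- rewrite -ltnS; apply: leq_trans card_n; apply: proper_card.
  apply/properP; split.
    apply/fintype.subsetP => j; rewrite !inE => /existsP[m gm]; apply/existsP; exists l0.
    case: (gap j) => // h; last exact: lt_le_trans l0i1 h.
    move: gm; rewrite /g' (@max_r _ _ (g j)) ?(le_trans h) ?ltW //.
    by rewrite ltNge le_max lexx orbT.
  exists i1; rewrite !inE; first by apply/existsP; exists l0.
  by apply/existsPn => m; rewrite -leNgt /g' maxxx le_max lexx orbT.
- have st0 : 0 <= s - t by rewrite subr_ge0 ltW.
  rewrite eqS; have := sc_nrmD S (\sum_j a j * iota (g j) -
    (\sum_(j | s <= g j) a j) * iota (s - t)) ((\sum_(j | s <= g j) a j) * iota (s - t)).
  rewrite subrK (sc_nrmM S) (sc_nrm_emb S) ger0_norm //.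
  move: big small; rewrite mulrSr; set N := _ * (s - t); set B := nrm _.
  set B' := nrm _; lra.
- move=> t' [s' [ts' gap' big']].
(* A level [s' <= s] would keep every index, and the total mass is 0. Above [s], the level sets of
   [g] and [g'] coincide. *)
have ss' : s < s'.
  rewrite ltNge; apply/negP => s's.
  move: big'; rewrite (eq_bigl xpredT) ?suma ?nrm0 ?mul0r; first by lra.
  by move=> j; rewrite /g' le_max s's orbT.
have leS j : (s' <= g' j) = (s' <= g j).
  by rewrite /g' le_max orbC leNgt ss'.
exists t', s'; split=> //; last by rewrite -(eq_bigl _ _ leS).
move=> j; case: (gap' j); last by rewrite leS; right.
by rewrite /g' ge_max => /andP[]; left.
Qed.

Lemma layer_cake (c : R) (g : I -> R) : 0 <= c ->
  c *+ #|I| < nrm (\sum_i a i * iota (g i)) ->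
  exists t s, [/\ t < s, forall i, g i <= t \/ s <= g i &
    c < nrm (\sum_(i | s <= g i) a i) * (s - t)].
Proof. by move=> c0; apply: layer_cake_rec => //; exact: max_card. Qed.

End LayerCake.

Section Evaluation.
Variables (M : Type) (d : M -> M -> R).
Hypothesis hd : is_metric d.

Definition ev (I : finType) (a : I -> K) (y : I -> M) (f : M -> R) : K :=
  \sum_i a i * iota (f (y i)).

Definition separated (I : finType) (y : I -> M) (A : {set I}) (s : R) :=
  forall i l, i \in A -> l \notin A -> s <= d (y i) (y l).

Lemma evB (I : finType) (a : I -> K) y f g :
  ev a y (fun x => f x - g x) = ev a y f - ev a y g.
Proof. by rewrite /ev -sumrB; apply: eq_bigr => i _; rewrite rmorphB mulrBr. Qed.

Lemma ev_le (I : finType) (a : I -> K) y f e : (forall i, `|f (y i)| <= e) ->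
  nrm (ev a y f) <= (\sum_i nrm (a i)) * e.
Proof.
move=> fe; apply: le_trans (nrm_sum _ _) _; rewrite mulr_suml.
by apply: ler_sum => i _; rewrite (sc_nrmM S) (sc_nrm_emb S) ler_wpM2l ?nrm_ge0.
Qed.

Lemma ev_raise (I : finType) (a : I -> K) y f g h (A : {set I}) :
  (forall i, g (y i) = f (y i) + (if i \in A then h else 0)) ->
  ev a y g = ev a y f + (\sum_(i in A) a i) * iota h.
Proof.
move=> gE; rewrite [in RHS]big_mkcond mulr_suml -big_split; apply: eq_bigr => i _ /=.
by rewrite gE; case: ifP => _; rewrite rmorphD mulrDr // rmorph0 mulr0 mul0r.
Qed.

(** Either the upper level set found by [layer_cake] or its complement misses [i0], and their masses
    are opposite. The gap between levels is a gap in distance because [f] is 1-Lipschitz. *)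
Lemma exists_separated (I : finType) (i0 : I) (a : I -> K) y f c :
  \sum_i a i = 0 -> lip1 d f -> 0 <= c -> c *+ #|I| < nrm (ev a y f) ->
  exists (A : {set I}) s, [/\ 0 < s, separated y A s,
    c < nrm (\sum_(i in A) a i) * s &
    forall i, i \in A -> f (y i) <> f (y i0)].
Proof.
move=> suma lf c0 /(layer_cake suma c0)[t [s [ts gap big]]].
case: (gap i0) => h0.
- exists [set i | s <= f (y i)], (s - t); rewrite subr_gt0; split=> //.
  + move=> i l; rewrite !inE => hi hl; have := lf (y i) (y l).
    by case: (gap l) => [|h]; [lra|rewrite h in hl].
  + by rewrite (eq_bigl (fun i => s <= f (y i))) // => i; rewrite inE.
  + by move=> i; rewrite inE; lra.
- exists [set i | ~~ (s <= f (y i))], (s - t); rewrite subr_gt0; split=> //.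
  + move=> i l; rewrite !inE negbK => hi hl; have := lf (y l) (y i).
    rewrite (dist_sym hd (y l)).
    by case: (gap i) => [|h]; [lra|rewrite h in hi].
  + rewrite (eq_bigl (fun i => ~~ (s <= f (y i)))); last by move=> i; rewrite inE.
    by rewrite -nrmN -(sum_compl suma).
  + by move=> i; rewrite inE => /negP h e; apply: h; rewrite e.
Qed.

End Evaluation.
End Scalars.

(** * Gliding humps *)

Section GlidingHump.
Variables (R : realType) (K : fieldType) (nrm : K -> R) (S : scalars nrm).
Variables (M : Type) (d : M -> M -> R) (x0 : M).
Hypothesis hd : is_metric d.
Variables (I : finType) (a : nat -> I -> K) (y : nat -> I -> M).
Local Notation gam n f := (ev S (a n) (y n) f).

(** A stage: the current function, the finite family of points where the next stage must nearly
    preserve it, the error allowed there, and the index of the combination treated last. *)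
Record hump_state := HumpState {
  hs_fun : M -> R;
  hs_idx : finType;
  hs_pt : hs_idx -> M;
  hs_tol : R;
  hs_time : nat }.

Definition hs_pts (st : hump_state) (p : M) := exists j, @hs_pt st j = p.

(* The McShane-type infimum below is within 2 tol of every stage on the points
   of that stage, whatever the later stages do elsewhere. *)
Lemma hump_limit (st : nat -> hump_state) :
  (exists p, hs_pts (st 0%N) p) ->
  (forall j, lip1 d (hs_fun (st j))) ->
  (forall j p, hs_pts (st j) p -> hs_pts (st j.+1) p) ->
  (forall j, 0 < hs_tol (st j)) ->
  (forall j, hs_tol (st j.+1) *+ 2 <= hs_tol (st j)) ->
  (forall j p, hs_pts (st j) p ->
     `|hs_fun (st j.+1) p - hs_fun (st j) p| <= hs_tol (st j)) ->
  exists f, lip1 d f /\ forall j p, hs_pts (st j) p ->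
     `|f p - hs_fun (st j) p| <= hs_tol (st j) *+ 2.
Proof.
move=> [q0 q0P] lf mono pos halve close.
have pts_le j m p : hs_pts (st j) p -> hs_pts (st (j + m)%N) p.
  by move=> h; elim: m => [|m IH]; rewrite ?addn0 // addnS; exact: mono.
(* The halving tolerances telescope: their sum from stage [j] on is at most twice the [j]-th one. *)
have cl j m p : hs_pts (st j) p ->
    `|hs_fun (st (j + m)%N) p - hs_fun (st j) p| <= hs_tol (st j) *+ 2.
  move=> h; suff : `|hs_fun (st (j + m)%N) p - hs_fun (st j) p| <=
      hs_tol (st j) *+ 2 - hs_tol (st (j + m)%N) *+ 2.
    by have := pos (j + m)%N; lra.
  elim: m => [|m IH]; first by rewrite addn0 !subrr normr0.
  have := close _ _ (pts_le j m p h); have := halve (j + m)%N.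
  rewrite addnS; move: IH; rewrite !ler_norml; lra.
pose E x : set R := fun z => exists j p, hs_pts (st j) p /\
  z = hs_fun (st j) p + hs_tol (st j) *+ 2 + d x p.
have lowE x j p : hs_pts (st j) p ->
    lbound (E x) (hs_fun (st j) p - hs_tol (st j) *+ 2 - d x p).
  move=> pj z [i [q [qi ->]]].
  have := cl _ j _ qi; have := cl _ i _ pj; rewrite (addnC i) !ler_norml.
  have := lf (j + i)%N p q; have := dist_tri hd x p q.
  by rewrite (dist_sym hd p x); lra.
have lbE x : has_lbound (E x).
  by exists (hs_fun (st 0%N) q0 - hs_tol (st 0%N) *+ 2 - d x q0); exact: lowE.
have neE x : nonempty (E x).
  by exists (hs_fun (st 0%N) q0 + hs_tol (st 0%N) *+ 2 + d x q0), 0%N, q0.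
exists (fun x => inf (E x)); split.
- move=> x z; rewrite lerBlDr addrC -lerBlDr; apply: lb_le_inf => // w [j [p [pj ->]]].
  have : inf (E x) <= hs_fun (st j) p + hs_tol (st j) *+ 2 + d x p.
    by apply: ge_inf => //; exists j, p.
  by have := dist_tri hd z x p; lra.
- move=> j p pj; rewrite ler_norml; apply/andP; split.
    have : hs_fun (st j) p - hs_tol (st j) *+ 2 - d p p <= inf (E p).
      by apply: lb_le_inf => //; exact: lowE.
    by rewrite (dist_self hd); lra.
  have : inf (E p) <= hs_fun (st j) p + hs_tol (st j) *+ 2 + d p p.
    by apply: ge_inf => //; exists j, p.
  by rewrite (dist_self hd); lra.
Qed.

(** Each stage is made large on one combination, then nearly frozen at its points, so the limit
    still sees that combination up to a loss of [c / 2]. The class [C] is an invariant of the stages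
    and need not pass to the limit. *)
Lemma gliding_hump (C : (M -> R) -> Prop) (c : R) (f0 : M -> R) :
  0 < c -> C f0 -> (forall f, C f -> lip1 d f) ->
  (forall f, C f -> forall (J : finType) (p : J -> M) (eta : R) N, 0 < eta ->
     exists n f', [/\ (N <= n)%N, C f', c <= nrm (gam n f') &
       forall j, `|f' (p j) - f (p j)| <= eta]) ->
  exists f, lip1 d f /\ forall N, exists n, (N <= n)%N /\ c / 2 <= nrm (gam n f).
Proof.
move=> c0 Cf0 Clip step.
pose valid st := C (hs_fun st) /\ 0 < hs_tol st.
pose next (st st' : hump_state) := [/\ valid st',
  (hs_time st < hs_time st')%N,
  (forall p, hs_pts st p -> hs_pts st' p /\
     `|hs_fun st' p - hs_fun st p| <= hs_tol st),
  hs_tol st' *+ 2 <= hs_tol st &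
  [/\ c <= nrm (gam (hs_time st') (hs_fun st')),
     (\sum_i nrm (a (hs_time st') i)) * (hs_tol st' *+ 2) <= c / 2 &
     forall i, hs_pts st' (y (hs_time st') i)]].
have nextP (st : {st | valid st}) : exists st' : {st | valid st},
    next (sval st) (sval st').
  case: st => -[f J p eta t] [Cf eta0] /=; rewrite /= in Cf eta0.
  have [n [f' [Nn Cf' big near_f]]] := step f Cf J p eta t.+1 eta0.
  pose B := \sum_i nrm (a n i).
  have B0 : 0 <= B by apply: sumr_ge0 => i _; exact: (nrm_ge0 S).
  (* The first bound halves the tolerance; the second limits the loss on combination [n] to [c / 2],
     with [B + 1] covering [B = 0]. *)
  pose eta' := Num.min (eta / 2) (c / 4 / (B + 1)).
  have eta'0 : 0 < eta' by rewrite lt_min !divr_gt0 //; lra.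
  pose st' := @HumpState f' (J + I)%type
    (fun j => match j with inl j => p j | inr i => y n i end) eta' n.
  have vst' : valid st' by [].
  exists (exist _ st' vst'); split=> //=.
  - move=> _ [j <-] /=; split; [by exists (inl j)|exact: near_f].
  - have : eta' <= eta / 2 by rewrite ge_min lexx.
    by lra.
  - split=> //; last by move=> i; exists (inr i).
    have h : eta' * (B + 1) <= c / 4.
      by rewrite -ler_pdivlMr ?ge_min ?lexx ?orbT //; lra.
    have h' : B * eta' <= eta' * (B + 1) by rewrite mulrDr mulrC mulr1 lerDl ltW.
    by rewrite -/B mulrnAr; lra.
have [F FP] := choice nextP.
have v0 : valid (@HumpState f0 unit (fun=> x0) 1 0) by [].
pose st j := iter j F (exist _ _ v0).
have nx j : next (sval (st j)) (sval (st j.+1)) := FP (st j).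
have [f [lf fP]] := @hump_limit (fun j => sval (st j))
  (ex_intro _ x0 (ex_intro _ tt erefl))
  (fun j => Clip _ (svalP (st j)).1)
  (fun j p h => let: And5 _ _ h' _ _ := nx j in (h' p h).1)
  (fun j => (svalP (st j)).2)
  (fun j => let: And5 _ _ _ h _ := nx j in h)
  (fun j p h => let: And5 _ _ h' _ _ := nx j in (h' p h).2).
exists f; split=> // N.
have time j : (j <= hs_time (sval (st j)))%N.
  by elim: j => // j IH; case: (nx j) => _ h _ _ _; exact: leq_ltn_trans IH h.
(* Stage 0 treats no combination, hence the shift to [N.+1]. *)
exists (hs_time (sval (st N.+1))); split.
  by apply: leq_trans (time N.+1); exact: leqnSn.
case: (nx N) => _ _ _ _ [big small yP]; set s' := sval _ in big small yP *.
have := @ev_le _ _ _ S _ _ (a (hs_time s')) (y (hs_time s'))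
  (fun x => f x - hs_fun s' x) (hs_tol s' *+ 2) (fun i => fP N.+1 _ (yP i)).
rewrite evB => h; have := sc_nrmD S (gam (hs_time s') f)
  (- (gam (hs_time s') f - gam (hs_time s') (hs_fun s'))).
rewrite (nrmN S) opprB addrC subrK; lra.
Qed.

End GlidingHump.

(** * Weakly null sequences *)

Section Ultrafilter.
Variable U : set (set nat).
Hypothesis UU : UltraFilter U.

Lemma ultra_em (P : nat -> Prop) : U P \/ U (fun n => ~ P n).
Proof. exact: in_ultra_setVsetC. Qed.

Lemma ultraI (P Q : nat -> Prop) : U P -> U Q -> U (fun n => P n /\ Q n).
Proof. exact: filterI. Qed.

Lemma ultraS (P Q : nat -> Prop) : (forall n, P n -> Q n) -> U P -> U Q.
Proof. by move=> PQ; apply: filterS. Qed.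

Lemma ultra_ex (P : nat -> Prop) : U P -> exists n, P n.
Proof. exact: filter_ex. Qed.

Lemma ultra_forall (J : finType) (P : J -> nat -> Prop) :
  (forall j, U (P j)) -> U (fun n => forall j, P j n).
Proof. by move=> h; apply: (@filter_forall nat J P). Qed.

Lemma ultra_const (T : finType) (F : nat -> T) : exists t, U (fun n => F n = t).
Proof.
apply: contrapT => none.
have : U (fun n => forall t, F n <> t).
  apply: ultra_forall => t; case: (ultra_em (fun n => F n = t)) => // h.
  by case: none; exists t.
by move/ultra_ex => [n /(_ (F n))].
Qed.

Lemma ultra_bounded (R : realType) (s : nat -> R) :
  (exists D, U (fun n => s n <= D)) \/ (forall D, U (fun n => D < s n)).
Proof.
case: (pselect (exists D, U (fun n => s n <= D))) => [|none]; first by left.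
right=> D; case: (ultra_em (fun n => s n <= D)) => [h|].
  by case: none; exists D.
by apply: ultraS => n /negP; rewrite -ltNge.
Qed.

Variables (R : realType) (M : Type) (d : M -> M -> R).

(** The image of [U] under [u] is a Cauchy filter; the centre may vary with [e], completeness not
    being assumed here. *)
Definition tight (u : nat -> M) :=
  forall e, 0 < e -> exists p, U (fun n => d p (u n) < e).

Lemma not_tight_escape (u : nat -> M) : ~ tight u ->
  exists2 e, 0 < e & forall p, U (fun n => e <= d p (u n)).
Proof.
move=> /existsNP[e /not_implyP[e0 none]]; exists e => // p.
case: (ultra_em (fun n => d p (u n) < e)) => [h|]; first by case: none; exists p.
by apply: ultraS => n /negP; rewrite -leNgt.
Qed.

Lemma escape_uniform (I : finType) (u : nat -> I -> M) :
  exists2 e, 0 < e & forall i, ~ tight (u ^~ i) ->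
    forall p, U (fun n => e <= d p (u n i)).
Proof.
have /choice[e eP] : forall i, exists e, 0 < e /\ (~ tight (u ^~ i) ->
    forall p, U (fun n => e <= d p (u n i))).
  move=> i; case: (pselect (tight (u ^~ i))) => [ti|/not_tight_escape[e e0 h]].
    by exists 1.
  by exists e.
exists (\big[Num.min/1]_i e i).
  by apply: lt_bigmin => // i _; case: (eP i).
move=> i ni p; have [_ /(_ ni p)] := eP i; apply: ultraS => n.
by apply: le_trans; exact: bigmin_le_cond.
Qed.

End Ultrafilter.

Lemma exists_ultrafilter : exists U : set (set nat),
  UltraFilter U /\ forall N, U (fun n => (N <= n)%N).
Proof.
have [U [UU h]] := ultraFilterLemma eventually_filter.
by exists U; split=> // N; apply: h; exists N.
Qed.

Section WeaklyNull.
Variables (R : realType) (K : fieldType) (nrm : K -> R) (S : scalars nrm).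
Variables (M : Type) (d : M -> M -> R) (x0 : M).
Hypothesis hd : is_metric d.
Variables (I : finType) (i0 : I) (a : nat -> I -> K) (y : nat -> I -> M).
Local Notation gam n f := (ev S (a n) (y n) f).
Hypothesis suma : forall n, \sum_i a n i = 0.
Hypothesis yi0 : forall n, y n i0 = x0.
Hypothesis wnull : forall f, lip1 d f ->
  forall e : R, 0 < e -> exists N, forall n, (N <= n)%N -> nrm (gam n f) < e.
Variable U : set (set nat).
Hypothesis UU : UltraFilter U.
Hypothesis Utail : forall N, U (fun n => (N <= n)%N).

Lemma ultra_wnull f e : lip1 d f -> 0 < e -> U (fun n => nrm (gam n f) < e).
Proof. by move=> lf /(wnull lf)[N h]; apply: ultraS (Utail N). Qed.

Lemma not_hump f c : 0 < c -> lip1 d f ->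
  (forall N, exists n, (N <= n)%N /\ c / 2 <= nrm (gam n f)) -> False.
Proof.
move=> c0 lf h; have c20 : 0 < c / 2 by lra.
have [N hN] := wnull lf c20; have [n [Nn big]] := h N.
by have := hN n Nn; lra.
Qed.

(** Gliding hump over all 1-Lipschitz functions: for tiny [s n], both functions given by [raise_on]
    stay within [eta] of [f], and their values differ by more than [c], so one of them has norm at
    least [c / 2]. *)
Lemma no_vanishing_separation (A : {set I}) (s : nat -> R) (c : R) : 0 < c ->
  U (fun n => [/\ 0 < s n, separated d (y n) A (s n) &
     c < nrm (\sum_(i in A) a n i) * s n]) ->
  (forall e, 0 < e -> U (fun n => s n <= e)) -> False.
Proof.
move=> c0 As s0.
have [||||f [lf fP]] := @gliding_hump _ _ _ S _ d x0 hd I a y (lip1 d) (c / 2)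
    (fun=> 0).
- by lra.
- exact: lip1_cst.
- by [].
- move=> f lf J p eta N eta0.
  have C0 : 0 < (#|I|.+1)%:R :> R by rewrite ltr0n.
  have /(ultra_ex UU)[n [[Nn [sn sep big]] small]] := ultraI UU
    (ultraI UU (Utail N) As) (s0 (eta / (#|I|.+1)%:R) (divr_gt0 eta0 C0)).
  have [g [g' [lg lg' gg' raise]]] := raise_on hd lf (ltW sn) sep.
  have small' : s n *+ #|I|.+1 <= eta by rewrite -mulr_natr -ler_pdivlMr.
  have := ev_raise S (a n) raise; set b := _ * sc_emb S _ => evE.
  have nb : c < nrm b by rewrite (sc_nrmM S) (sc_nrm_emb S) gtr0_norm.
  have := nrmB S (gam n g') (gam n g); rewrite evE addrAC subrr add0r => tri.
  case: (leP (c / 2) (nrm (gam n g))) => hg.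
    exists n, g; split=> // j; have [/andP[]] := gg' (p j).
    by rewrite ler_norml; lra.
  exists n, g'; split=> //; first by rewrite evE; lra.
  by move=> j; have [/andP[]] := gg' (p j); rewrite ler_norml; lra.
- by apply: (@not_hump f (c / 2)) => //; lra.
Qed.

(** Gliding hump with tents. The first distance hypothesis keeps a new tent off prescribed points;
    the second, where [n] is fixed because [h] may vary, makes later points of [B] avoid that
    tent. *)
Lemma no_escaping_humps (B : {set I}) (h : nat -> R) (c : R) : 0 < c ->
  U (fun n => [/\ 0 < h n, separated d (y n) B (h n) &
     c < nrm (\sum_(i in B) a n i) * h n]) ->
  (forall p, U (fun n => forall i, i \in B -> h n <= d p (y n i))) ->
  (forall p n, U (fun m => forall i, i \in B -> h n <= d p (y m i))) -> False.
Proof.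
move=> c0 Bh far1 far2.
(* Vanishing on [B] lets the next tent add exactly [h n] there; nonnegativity lets the maximum leave
   [f] alone where the tent is 0. *)
pose C f := [/\ lip1 d f, forall x, 0 <= f x &
  U (fun m => forall i, i \in B -> f (y m i) = 0)].
have [||||f [lf fP]] := @gliding_hump _ _ _ S _ d x0 hd I a y C (c / 2) (fun=> 0).
- by lra.
- split=> //; first exact: lip1_cst.
  by apply: ultraS (Utail 0).
- by move=> f [].
- move=> f [lf f0 fB] J p eta N eta0.
  have c20 : 0 < c / 2 by lra.
  have /(ultra_ex UU)[n [[[Nn [hn sep big]] [fBn fn]] farp]] := ultraI UU
    (ultraI UU (ultraI UU (Utail N) Bh) (ultraI UU fB (ultra_wnull lf c20)))
    (ultra_forall UU (fun j => far1 (p j))).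
  pose f' x := Num.max (f x) (tent d B (y n) (h n) x).
  have raise i : f' (y n i) = f (y n i) + (if i \in B then h n else 0).
    rewrite /f'; case: ifPn => iB.
      by rewrite fBn // tent_center ?ltW // add0r max_r ?ltW.
    rewrite tent_far ?max_l ?addr0 // => l lB.
    by rewrite (dist_sym hd); exact: sep.
  exists n, f'; split=> //.
  + split.
    * apply: lip1_max => //; exact: tent_lip1.
    * by move=> x; rewrite le_max f0.
    * apply: ultraS (ultraI UU fB (ultra_forall UU (fun l => far2 (y n l) n))).
      move=> m [fm farm] i iB; rewrite /f' fm // tent_far ?maxxx // => l lB.
      by rewrite (dist_sym hd); exact: farm.
  + rewrite (ev_raise S (a n) raise).
    set b := _ * sc_emb S _.
    have nb : c < nrm b by rewrite (sc_nrmM S) (sc_nrm_emb S) gtr0_norm.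
    have := nrmB S (gam n f + b) (gam n f); rewrite addrAC subrr add0r; lra.
  + move=> j; rewrite /f' tent_far ?max_l ?subrr ?normr0 ?(ltW eta0) //.
    exact: farp.
- by apply: (@not_hump f (c / 2)) => //; lra.
Qed.

(** The points of [A] settle near fixed centres, so one plateau around these isolates the mass of
    [A] along [U], against weak nullity. *)
Lemma no_tight_separation (A : {set I}) (r c : R) : 0 < c -> 0 < r ->
  (forall i, i \in A -> tight U d (y ^~ i)) ->
  (forall i, i \notin A -> tight U d (y ^~ i) \/
    forall p, U (fun n => r <= d p (y n i))) ->
  U (fun n => forall i l, i \in A -> l \notin A -> tight U d (y ^~ l) ->
     r <= d (y n i) (y n l)) ->
  U (fun n => c < nrm (\sum_(i in A) a n i)) -> False.
Proof.
move=> c0 r0 tA tN sep big.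
have r16 : 0 < r / 16 by lra.
have /choice[p pP] : forall i, exists p, i \in A ->
    U (fun n => d p (y n i) < r / 16).
  move=> i; case: (boolP (i \in A)) => iA; last by exists x0.
  by have [p hp] := tA i iA _ r16; exists p.
(* At the points of [A] the tent is at least [r / 4 - r / 16], so the cap gives exactly [r / 8]; all
   other points will be farther than [r / 4] from the centres. *)
pose f x := Num.min (r / 8) (tent d A p (r / 4) x).
have lf : lip1 d f by apply: lip1_min; [exact: lip1_cst|exact: tent_lip1].
have near_p : U (fun n => forall i, i \in A -> d (p i) (y n i) < r / 16).
  apply: (ultra_forall UU) => i; case: (boolP (i \in A)) => iA.
    by apply: (ultraS UU) (pP i iA).
  by apply: (ultraS UU) (Utail 0).
have farN : U (fun n => forall l, l \notin A -> ~ tight U d (y ^~ l) ->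
    forall i, r <= d (p i) (y n l)).
  apply: (ultra_forall UU) => l; case: (boolP (l \in A)) => lA.
    by apply: (ultraS UU) (Utail 0).
  case: (tN l lA) => [tl|far]; first by apply: (ultraS UU) (Utail 0).
  by apply: (ultraS UU) (ultra_forall UU (fun i => far (p i))).
have e0 : 0 < c * (r / 8) by apply: mulr_gt0; lra.
have /(ultra_ex UU)[n [[np fN] [[sp bg] sm]]] := ultraI UU (ultraI UU near_p farN)
   (ultraI UU (ultraI UU sep big) (ultra_wnull lf e0)).
have raise i : f (y n i) = (fun=> 0) (y n i) + (if i \in A then r / 8 else 0).
  rewrite add0r /f; case: ifPn => iA.
    apply: min_l; have := tent_ge d p (r / 4) (y n i) iA; have := np i iA.
    by rewrite (dist_sym hd (p i)); lra.
  rewrite tent_far ?min_r //; first by lra.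
  move=> l lA; rewrite (dist_sym hd); case: (pselect (tight U d (y ^~ i))) => ti.
    have := sp l i lA iA ti; have := np l lA; have := dist_tri hd (p l) (y n l) (y n i).
    by rewrite (dist_sym hd (y n l) (p l)); lra.
  by have := fN i iA ti l; lra.
have fE : gam n f = (\sum_(i in A) a n i) * sc_emb S (r / 8).
  rewrite (@ev_raise _ _ _ S _ _ (a n) (y n) (fun=> 0) f _ A raise).
  by rewrite /ev big1 ?add0r // => i _; rewrite rmorph0 mulr0.
move: sm; rewrite fE (sc_nrmM S) (sc_nrm_emb S) gtr0_norm; last by lra.
by rewrite ltNge ler_wpM2r //; lra.
Qed.

(** The base point has an index outside [A], hence lies at distance at least [s n] from the points
    of [A]; replacing [x0] by [p] costs at most half of a large [s n]. *)
Lemma unbounded_separation_far (A : {set I}) (s : nat -> R) :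
  i0 \notin A -> U (fun n => separated d (y n) A (s n)) ->
  (forall D, U (fun n => D < s n)) ->
  forall p, U (fun n => forall i, i \in A -> s n / 2 <= d p (y n i)).
Proof.
move=> i0A As sinf p.
apply: (ultraS UU) (ultraI UU As (sinf (2 * d x0 p))) => n [sep sn] i iA.
have := sep i i0 iA i0A; rewrite yi0 (dist_sym hd) => h.
by have := dist_tri hd p x0 (y n i); lra.
Qed.

Lemma weakly_null_not_normed (e : R) : 0 < e ->
  (forall n, exists f, lip1 d f /\ e < nrm (gam n f)) -> False.
Proof.
move=> e0 normed.
have cI : 0 < #|I|%:R :> R by rewrite ltr0n; apply/card_gt0P; exists i0.
pose c := e / #|I|%:R; have c0 : 0 < c by exact: divr_gt0.
have /choice[F FP] : forall n, exists As : {set I} * R,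
    [/\ 0 < As.2, separated d (y n) As.1 As.2,
        c < nrm (\sum_(i in As.1) a n i) * As.2 & i0 \notin As.1].
  move=> n; have [f [lf big]] := normed n.
  have [|A [s [s0 sep cs fi]]] := exists_separated (c := c) hd i0 (suma n) lf
    (ltW c0) (S := S) (y := y n).
    by rewrite -[c *+ _]mulr_natr divfK ?gt_eqF.
  by exists (A, s); split=> //=; apply/negP => /fi.
(* There are finitely many subsets of [I], so the selected set is constant along [U]. *)
pose s n := (F n).2; have [A UA] := ultra_const UU (fun n => (F n).1).
have As : U (fun n => [/\ 0 < s n, separated d (y n) A (s n) &
     c < nrm (\sum_(i in A) a n i) * s n]).
  by apply: (ultraS UU) UA => n <-; case: (FP n).
have i0A : i0 \notin A by have [n <-] := ultra_ex UU UA; case: (FP n).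
case: (pselect (forall e, 0 < e -> U (fun n => s n <= e))).
  exact: (no_vanishing_separation c0 As).
move=> /existsNP[eta /not_implyP[eta0]].
case: (ultra_em UU (fun n => s n <= eta)) => // s_ge _.
have {}s_ge : U (fun n => eta <= s n).
  by apply: (ultraS UU) s_ge => n /negP; rewrite -ltNge => /ltW.
case: (ultra_bounded UU s) => [[D sD]|sinf]; last first.
  have far p : U (fun n => forall i, i \in A -> s n / 2 <= d p (y n i)).
    by apply: unbounded_separation_far => //; apply: (ultraS UU) As => n [].
  apply: (@no_escaping_humps A (fun n => s n / 2) (c / 2)) => //; first by lra.
    apply: (ultraS UU) As => n [sn sep big]; split; first by lra.
      by move=> i l iA lA; have := sep i l iA lA; lra.
    by move: big; rewrite mulrA; lra.
  move=> p n; apply: (ultraS UU) (ultraI UU (far p) (sinf (s n))) => m [h1 h2] i iA.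
  by have := h1 i iA; lra.
have D0 : 0 < D.
  by have [n [[sn _ _] snD]] := ultra_ex UU (ultraI UU As sD); lra.
have [r0 r00 escape] := escape_uniform UU d y.
pose r := Num.min r0 eta; have r_gt0 : 0 < r by rewrite lt_min r00.
have r_r0 : r <= r0 by rewrite ge_min lexx.
have r_eta : r <= eta by rewrite ge_min lexx orbT.
have {}escape i : ~ tight U d (y ^~ i) -> forall p, U (fun n => r <= d p (y n i)).
  by move=> ni p; apply: (ultraS UU) (escape i ni p) => n; exact: le_trans.
pose T := [set i | `[< tight U d (y ^~ i) >]].
(* As [s n <= D], the mass of [A] exceeds [c / D] in norm; its tight or its escaping part then has
   norm at least half of that. *)
pose c' := c / D / 2.
have c'0 : 0 < c' by rewrite !divr_gt0.
case: (ultra_em UU (fun n => c' < nrm (\sum_(i in A :&: T) a n i))) => [bigT|smallT].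
  apply: (@no_tight_separation (A :&: T) r c') => //.
  - by move=> i; rewrite !inE => /andP[_ /asboolP].
  - move=> i _; case: (pselect (tight U d (y ^~ i))) => [|ni]; first by left.
    by right=> p; exact: escape.
  - apply: (ultraS UU) (ultraI UU As s_ge) => n [[_ sep _] sn] i l.
    rewrite !inE => /andP[iA _] /nandP[lA|/asboolP//] _.
    by have := sep i l iA lA; lra.
pose B := A :\: T.
have r4 : 0 < r / 4 by lra.
have /choice[p pP] : forall l, exists p, l \in T ->
    U (fun n => d p (y n l) < r / 4).
  move=> l; case: (boolP (l \in T)) => lT; last by exists x0.
  by move: lT; rewrite inE => /asboolP/(_ _ r4)[p hp]; exists p.
have near_p : U (fun n => forall l, l \in T -> d (p l) (y n l) < r / 4).
  apply: (ultra_forall UU) => l; case: (boolP (l \in T)) => lT.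
    by apply: (ultraS UU) (pP l lT).
  by apply: (ultraS UU) (Utail 0).
have farB q : U (fun n => forall i, i \in B -> r <= d q (y n i)).
  apply: (ultra_forall UU) => i; case: (boolP (i \in B)) => iB.
    move: (iB); rewrite !inE => /andP[/asboolP ni _].
    by apply: (ultraS UU) (escape i ni q).
  by apply: (ultraS UU) (Utail 0).
have farB2 q : U (fun n => forall i, i \in B -> r / 2 <= d q (y n i)).
  by apply: (ultraS UU) (farB q) => n h i iB; have := h i iB; lra.
(* Height [r / 2]: escaping points are [r] away from centres that lie within [r / 4] of the tight
   points, and indices outside [A] are separated by at least [eta >= r]. The factor [r / 4] leaves a
   strict inequality. *)
apply: (@no_escaping_humps B (fun=> r / 2) (c' * (r / 4))) => //.
  by apply: mulr_gt0.
apply: (ultraS UU) (ultraI UU (ultraI UU As (ultraI UU sD s_ge)) (ultraI UU smallT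
  (ultraI UU near_p (ultra_forall UU (fun l => farB (p l)))))).
move=> n [[[sn sep big] [snD sneta]] [smallTn [np fB]]]; split.
- by lra.
- move=> i l iB lB; move: (iB); rewrite !inE => /andP[iT iA].
  case: (boolP (l \in A)) => lA; last by have := sep i l iA lA; lra.
  have lT : l \in T by move: lB; rewrite inE lA andbT negbK.
  have := fB l i iB; have := np l lT; have := dist_tri hd (y n l) (p l) (y n i).
  by rewrite (dist_sym hd (y n i)); lra.
- have sumA : \sum_(i in A) a n i = \sum_(i in A :&: T) a n i + \sum_(i in B) a n i.
    by rewrite (big_setID T).
  move/negP: smallTn; rewrite -leNgt => smallTn.
  have bigA : c / D < nrm (\sum_(i in A) a n i).
    rewrite ltr_pdivrMr //; apply: lt_le_trans big _.
    by rewrite ler_wpM2l ?(nrm_ge0 S).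
  have := sc_nrmD S (\sum_(i in A :&: T) a n i) (\sum_(i in B) a n i).
  rewrite -sumA => tri.
  have h : c' <= nrm (\sum_(i in B) a n i) by rewrite /c' in smallTn *; lra.
  have h1 : c' * (r / 2) <= nrm (\sum_(i in B) a n i) * (r / 2).
    by rewrite ler_wpM2r //; lra.
  have h2 : c' * (r / 4) < c' * (r / 2) by rewrite ltr_pM2l //; lra.
  exact: lt_le_trans h2 h1.
Qed.

End WeaklyNull.

(** * Norm convergence and the support of the limit *)

Lemma inv_succ_small (R : realType) (e : R) : 0 < e ->
  exists N, forall n, (N <= n)%N -> n.+1%:R^-1 < e.
Proof.
move=> e0; exists (Num.bound e^-1) => n Nn.
have e'0 : 0 <= e^-1 by rewrite invr_ge0 ltW.
have h : e^-1 < n.+1%:R.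
  apply: lt_le_trans (archi_boundP e'0) _; rewrite ler_nat; exact: leqW.
by rewrite -[ltRHS]invrK ltf_pV2 // posrE ?invr_gt0 // ltr0n.
Qed.

(** Centres of balls of radius [1/(j+1)] form a Cauchy sequence, since any two sets of [U] meet;
    their limit is the required point. *)
Lemma tight_limit (R : realType) (M : Type) (d : M -> M -> R) (U : set (set nat))
    (u : nat -> M) :
  is_metric d -> complete_metric d -> UltraFilter U -> tight U d u ->
  exists l, forall e, 0 < e -> U (fun n => d l (u n) < e).
Proof.
move=> hd hc UU tu.
have /choice[p pP] : forall j : nat, exists p, U (fun n => d p (u n) < j.+1%:R^-1).
  by move=> j; apply: tu; rewrite invr_gt0 ltr0n.
have [e e0|l lP] := hc p.
  have e20 : 0 < e / 2 by lra.
  have [N NP] := inv_succ_small e20; exists N => i j Ni Nj.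
  have [n [hi hj]] := ultra_ex UU (ultraI UU (pP i) (pP j)).
  have := dist_tri hd (u n) (p i) (p j); rewrite (dist_sym hd (u n)).
  by have := lt_trans hi (NP i Ni); have := lt_trans hj (NP j Nj); lra.
exists l => e e0; have e20 : 0 < e / 2 by lra.
have [N NP] := inv_succ_small e20; have [N' NP'] := lP _ e20.
pose j := maxn N N'.
have h1 := NP j (leq_maxl _ _); have h2 := NP' j (leq_maxr _ _).
apply: (ultraS UU) (pP j) => n /lt_trans/(_ h1) h; have := dist_tri hd (p j) l (u n).
by rewrite (dist_sym hd l (p j)); lra.
Qed.

Section FreeSpace.
Variables (R : realType) (K : fieldType) (nrm : K -> R) (S : scalars nrm).
Variables (M : Type) (d : M -> M -> R) (x0 : M).
Hypothesis hd : is_metric d.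
Local Notation iota := (sc_emb S).
Local Notation emb f := (fun x => iota (f x)).
Local Notation Lip := (Lip0 nrm d x0).

Lemma lipconst_emb f : lip1 d f -> lipconst nrm d (emb f) 1.
Proof.
move=> lf; split=> // x y.
by rewrite -rmorphB (sc_nrm_emb S) mul1r; exact: lip1_abs.
Qed.

Lemma Lip_emb f : lip1 d f -> f x0 = 0 -> Lip (emb f).
Proof.
by move=> lf f0; split; [rewrite f0 rmorph0|exists 1; exact: lipconst_emb].
Qed.

Lemma Lip_comb a g h : Lip g -> Lip h -> Lip (fun x => a * g x + h x).
Proof.
move=> [g0 [Lg [Lg0 gP]]] [h0 [Lh [Lh0 hP]]]; split.
  by rewrite g0 h0 mulr0 addr0.
exists (nrm a * Lg + Lh); split; first by rewrite addr_ge0 ?mulr_ge0 ?(nrm_ge0 S).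
move=> x y; rewrite [X in nrm X](_ : _ = a * (g x - g y) + (h x - h y)); last by ring.
apply: le_trans (sc_nrmD S _ _) _; rewrite mulrDl lerD // (sc_nrmM S) -mulrA.
by rewrite ler_wpM2l ?(nrm_ge0 S).
Qed.

Lemma lipconst_re g L : lipconst nrm d g L ->
  forall x y, `|sc_re S (g x) - sc_re S (g y)| <= L * d x y.
Proof.
move=> [_ gL] x y; rewrite -sc_reB.
by apply: le_trans (gL x y); exact: sc_re_le.
Qed.

Lemma lipconst_im g L : lipconst nrm d g L ->
  forall x y, `|sc_im S (g x) - sc_im S (g y)| <= L * d x y.
Proof.
move=> [_ gL] x y; rewrite -sc_imB.
by apply: le_trans (gL x y); exact: sc_im_le.
Qed.

Lemma lip1_div (f : M -> R) L : 0 < L ->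
  (forall x y, `|f x - f y| <= L * d x y) -> lip1 d (fun x => f x / L).
Proof.
move=> L0 fL x y; rewrite -mulrBl ler_pdivrMr // mulrC.
exact: le_trans (ler_norm _) (fL x y).
Qed.

Section Evaluations.
Variables (I : finType) (a : I -> K) (y : I -> M).
Hypothesis suma : \sum_i a i = 0.

(** Constants are invisible at total mass 0, which frees real test functions from vanishing at
    [x0]. *)
Lemma ev_shift f c : ev S a y (fun x => f x - c) = ev S a y f.
Proof. by rewrite evB /ev (sum_const_eq0 S suma (g := fun=> c)) ?subr0. Qed.

Lemma ev_lip (f : M -> R) e L : (forall f, lip1 d f -> nrm (ev S a y f) <= e) ->
  0 <= L -> (forall x y, `|f x - f y| <= L * d x y) ->
  nrm (ev S a y f) <= e * L.
Proof.
move=> evle; rewrite le_eqVlt => /predU1P[<-|L0] fL.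
  rewrite mulr0 /ev (sum_const_eq0 S suma) ?(nrm0 S) // => i j.
  by have := fL (y i) (y j); rewrite mul0r normr_le0 subr_eq0 => /eqP->.
have -> : ev S a y f = ev S a y (fun x => f x / L) * iota L.
  rewrite /ev mulr_suml; apply: eq_bigr => i _.
  by rewrite -mulrA -rmorphM divfK ?gt_eqF.
rewrite (sc_nrmM S) (sc_nrm_emb S) gtr0_norm // ler_wpM2r ?(ltW L0) //.
by apply: evle; exact: lip1_div.
Qed.

(** Real and imaginary parts are tested separately, whence the factor 2. *)
Lemma sum_opnorm g e L : (forall f, lip1 d f -> nrm (ev S a y f) <= e) ->
  lipconst nrm d g L -> nrm (\sum_i a i * g (y i)) <= e * 2 * L.
Proof.
move=> evle gL; have [L0 _] := gL.
have -> : \sum_i a i * g (y i) = sc_unit S * ev S a y (fun x => sc_im S (g x)) +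
    ev S a y (fun x => sc_re S (g x)).
  rewrite /ev mulr_sumr -big_split; apply: eq_bigr => i _ /=.
  by rewrite [in LHS](sc_decomp S (g (y i))); ring.
apply: le_trans (sc_nrmD S _ _) _; rewrite (sc_nrmM S).
have h1 := ev_lip evle L0 (lipconst_re gL); have h2 := ev_lip evle L0 (lipconst_im gL).
have h3 : nrm (sc_unit S) * nrm (ev S a y (fun x => sc_im S (g x))) <=
    nrm (ev S a y (fun x => sc_im S (g x))).
  by rewrite ler_piMl ?(nrm_ge0 S) ?(sc_nrm_unit S).
by move: h1 h2 h3; set u := e * L; rewrite (_ : e * 2 * L = u *+ 2) /u; [lra|ring].
Qed.

End Evaluations.

(** The base point is added at [ord0] with the opposite of the total mass; functions in [Lip0]
    vanish there. *)
Lemma in_FS_total0 k phi : in_FS nrm d x0 k phi ->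
  exists ay : ('I_k.+1 -> K) * ('I_k.+1 -> M), [/\ \sum_i ay.1 i = 0,
    ay.2 ord0 = x0 & forall g, Lip g -> phi g = \sum_i ay.1 i * g (ay.2 i)].
Proof.
move=> [a [xs phiE]].
pose a' i := if unlift ord0 i is Some j then a j else - \sum_j a j.
pose y i := if unlift ord0 i is Some j then xs j else x0.
have aE : \sum_(j < k) a' (lift ord0 j) = \sum_j a j.
  by apply: eq_bigr => j _; rewrite /a' liftK.
exists (a', y); split=> /=.
- by rewrite big_ord_recl aE /a' unlift_none addrC subrr.
- by rewrite /y unlift_none.
- move=> g Lg; rewrite phiE // big_ord_recl /y unlift_none (proj1 Lg) mulr0 add0r.
  by apply: eq_bigr => j _; rewrite /a' liftK.
Qed.

Lemma weak_cvg_eval gs gam g : weak_cvg nrm d x0 gs gam -> Lip g ->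
  forall e, 0 < e -> exists N, forall n, (N <= n)%N -> nrm (gs n g - gam g) < e.
Proof.
move=> wc [g0 [L gL]]; apply: (wc (fun phi => phi g)); split=> //.
exists L; split; first by case: gL.
by move=> phi e _ ole; rewrite mulrC; exact: ole.
Qed.

Section SpanOfKernel.
Variable p : nat -> M.

(** Induction on [m]: a function vanishing at the first [m] points but not at [p m] determines the
    last coefficient; if none exists, the last evaluation adds no constraint. *)
Lemma span_of_kernel (m : nat) (phi : (M -> K) -> K) :
  (forall a g h, Lip g -> Lip h ->
     phi (fun x => a * g x + h x) = a * phi g + phi h) ->
  (forall f, Lip f -> (forall j, (j < m)%N -> f (p j) = 0) -> phi f = 0) ->
  exists b : nat -> K, forall f, Lip f -> phi f = \sum_(j < m) b j * f (p j).
Proof.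
elim: m phi => [|m IH] phi lin ker.
  by exists (fun=> 0) => f Lf; rewrite big_ord0 ker.
case: (pselect (exists e, [/\ Lip e, forall j, (j < m)%N -> e (p j) = 0 &
    e (p m) != 0])) => [[e [Le e0 em]]|none].
  pose t := phi e / e (p m).
  have [a g h Lg Lh|f Lf f0|b bP] := IH (fun f => phi f - f (p m) * t).
  - by rewrite lin //; ring.
  - have := lin (- (f (p m) / e (p m))) e f Le Lf; rewrite ker.
    + by move/esym/eqP; rewrite mulNr addrC subr_eq0 => /eqP->; rewrite /t; ring.
    + exact: Lip_comb.
    + move=> j; rewrite ltnS leq_eqVlt => /predU1P[->|jm].
        by rewrite mulNr divfK // addNr.
      by rewrite (e0 j) // (f0 j) // mulr0 addr0.
  - exists (fun j => if j == m then t else b j) => f Lf.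
    rewrite big_ord_recr /= eqxx.
    rewrite (eq_bigr (fun j : 'I_m => b j * f (p j))) => [|j _]; last first.
      by rewrite ltn_eqF.
    by rewrite -bP // mulrC subrK.
have [//|f Lf f0|b bP] := IH phi.
  apply: ker => // j; rewrite ltnS leq_eqVlt => /predU1P[->|]; last exact: f0.
  by apply: contrapT => /eqP fm; apply: none; exists f.
exists (fun j => if j == m then 0 else b j) => f Lf.
rewrite big_ord_recr /= eqxx mul0r addr0 bP //.
by apply: eq_bigr => j _; rewrite ltn_eqF.
Qed.

End SpanOfKernel.

Section Difference.
Variables (I : finType) (a b : I -> K) (y z : I -> M).

(** A difference becomes a single combination over [I + I], to which the results on weakly null
    sequences apply. *)
Definition sub_coef (i : I + I) : K :=
  match i with inl i => a i | inr i => - b i end.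

Definition sub_pt (i : I + I) : M :=
  match i with inl i => y i | inr i => z i end.

Lemma sub_sumE (g : M -> K) : \sum_i sub_coef i * g (sub_pt i) =
  \sum_i a i * g (y i) - \sum_i b i * g (z i).
Proof.
rewrite big_sumType /= -sumrN; congr (_ + _).
by apply: eq_bigr => i _; rewrite mulNr.
Qed.

Lemma ev_sub f : ev S sub_coef sub_pt f = ev S a y f - ev S b z f.
Proof. exact: (sub_sumE (emb f)). Qed.

Lemma sub_total0 : \sum_i a i = 0 -> \sum_i b i = 0 -> \sum_i sub_coef i = 0.
Proof. by move=> sa sb; rewrite big_sumType /= sa sumrN sb subrr. Qed.

End Difference.

Section Convergence.
Variables (I : finType) (i0 : I) (a : nat -> I -> K) (y : nat -> I -> M).
Variables (gs : nat -> (M -> K) -> K) (gam : (M -> K) -> K).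
Hypothesis suma : forall n, \sum_i a n i = 0.
Hypothesis yi0 : forall n, y n i0 = x0.
Hypothesis gsE : forall n g, Lip g -> gs n g = \sum_i a n i * g (y n i).

Lemma gs_emb n f : lip1 d f -> ev S (a n) (y n) f = gs n (emb (fun x => f x - f x0)).
Proof.
move=> lf; rewrite -(ev_shift (y n) (suma n) f (f x0)) gsE //.
by apply: Lip_emb; [exact: lip1_shift|rewrite subrr].
Qed.

Section Cauchy.
Hypothesis wc : weak_cvg nrm d x0 gs gam.

(** Otherwise differences of ever later terms form a weakly null sequence of combinations bounded
    away from 0, against [weakly_null_not_normed]. *)
Lemma ev_cauchy e : 0 < e -> exists N, forall n m, (N <= n)%N -> (N <= m)%N ->
  forall f, lip1 d f -> nrm (ev S (a n) (y n) f - ev S (a m) (y m) f) <= e.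
Proof.
move=> e0; apply: contrapT => /forallNP none.
have /choice[q qP] : forall N, exists q : nat * nat, [/\ (N <= q.1)%N, (N <= q.2)%N &
    exists f, lip1 d f /\ e < nrm (ev S (a q.1) (y q.1) f - ev S (a q.2) (y q.2) f)].
  move=> N; have /existsNP[n /existsNP[m]] := none N.
  move=> /not_implyP[Nn /not_implyP[Nm /existsNP[f /not_implyP[lf /negP]]]].
  by rewrite -ltNge => h; exists (n, m); split=> //; exists f.
pose b N := sub_coef (a (q N).1) (a (q N).2).
pose z N := sub_pt (y (q N).1) (y (q N).2).
have evE N f : ev S (b N) (z N) f =
    ev S (a (q N).1) (y (q N).1) f - ev S (a (q N).2) (y (q N).2) f.
  exact: ev_sub.
have [U [UU Utail]] := exists_ultrafilter.
apply: (@weakly_null_not_normed _ _ _ S _ d x0 hd _ (inl i0) b z _ _ _ U UU Utail e e0).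
- by move=> N; exact: sub_total0.
- by move=> N /=; exact: yi0.
- move=> f lf r r0; pose f' x := f x - f x0.
  have Lf' : Lip (emb f') by apply: Lip_emb; [exact: lip1_shift|rewrite /f' subrr].
  have r20 : 0 < r / 2 by lra.
  have [N NP] := weak_cvg_eval wc Lf' r20; exists N => n Nn; rewrite evE !gs_emb //.
  have [n1 n2 _] := qP n.
  have h1 := NP _ (leq_trans Nn n1); have h2 := NP _ (leq_trans Nn n2).
  have := nrmB S (gs (q n).1 (emb f') - gam (emb f'))
    (gs (q n).2 (emb f') - gam (emb f')).
  by rewrite opprB addrA subrK; lra.
- by move=> N; have [_ _ [f [lf big]]] := qP N; exists f; rewrite evE.
Qed.

(** The Cauchy estimate at [e / 2], doubled by [sum_opnorm], bounds [gs n - gs m]; as [m] may depend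
    on [g], weak convergence suffices to replace [gs m] by [gam]. *)
Lemma weak_norm_cvg : norm_cvg nrm d x0 gs gam.
Proof.
move=> e e0; have e20 : 0 < e / 2 by lra.
have [N NP] := ev_cauchy e20; exists N => n Nn g L g0 gL.
have Lg : Lip g by split=> //; exists L.
apply/ler_addgt0Pl => r r0; have [N' NP'] := weak_cvg_eval wc Lg r0.
pose m := maxn N N'.
have h1 := NP' m (leq_maxr _ _).
pose b := sub_coef (a n) (a m); pose z := sub_pt (y n) (y m).
have sb : \sum_i b i = 0 by exact: sub_total0.
have evle f : lip1 d f -> nrm (ev S b z f) <= e / 2.
  move=> lf; rewrite ev_sub; exact: (NP n m Nn (leq_maxl _ _) f lf).
have h2 : nrm (gs n g - gs m g) <= e * L.
  rewrite !gsE // -(sub_sumE (a n) (a m)).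
  by have := sum_opnorm sb evle gL; rewrite divfK ?pnatr_eq0.
have := sc_nrmD S (gs n g - gs m g) (gs m g - gam g).
by rewrite addrA subrK; lra.
Qed.

End Cauchy.

(** * The support of the limit *)

Section Closed.
Hypothesis nc : norm_cvg nrm d x0 gs gam.
Hypothesis Fgam : in_Free nrm d x0 gam.
Variable U : set (set nat).
Hypothesis UU : UltraFilter U.
Hypothesis Utail : forall N, U (fun n => (N <= n)%N).

(* Tents on A_n eventually avoid any finite set, hence gam, being nearly
   finitely supported, does not see them. *)
Lemma no_escaping_mass (A : {set I}) (h : nat -> R) (c : R) : 0 < c -> i0 \notin A ->
  U (fun n => [/\ 0 < h n, separated d (y n) A (h n) &
     c <= nrm (\sum_(i in A) a n i) * h n]) ->
  (forall p, U (fun n => forall i, i \in A -> h n <= d p (y n i))) -> False.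
Proof.
(* Approximation by [psi] and norm convergence cost [c / 4] each, leaving at most [c / 2] for a
   value of norm at least [c]. *)
move=> c0 i0A Ah far; have c40 : 0 < c / 4 by lra.
have [_ /(_ _ c40)[psi [[m [b [q psiE]]] gpsi]]] := Fgam.
have [N NP] := nc c40.
have /(ultra_ex UU)[n [[Nn [hn sep big]] farq]] := ultraI UU
  (ultraI UU (Utail N) Ah) (ultra_forall UU (fun j => far (q j))).
pose v := tent d A (y n) (h n).
have lv : lip1 d v by exact: tent_lip1.
have v0 : v x0 = 0.
  by apply: tent_far => i iA; rewrite (dist_sym hd) -(yi0 n); exact: sep.
have Lv : Lip (emb v) by exact: Lip_emb.
have ev0 : iota (v x0) = 0 by rewrite v0 rmorph0.
have := gpsi _ _ ev0 (lipconst_emb lv); rewrite psiE // big1 => [|j _]; last first.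
  by rewrite /delta /v tent_far ?rmorph0 ?mulr0 //; exact: farq.
rewrite subr0 => h1; have h2 := NP n Nn _ _ ev0 (lipconst_emb lv).
have h3 := sc_nrmD S (gs n (emb v) - gam (emb v)) (gam (emb v)).
have vE i : v (y n i) = (fun=> 0) (y n i) + (if i \in A then h n else 0).
  rewrite add0r /v; case: ifPn => iA; first by rewrite tent_center ?ltW.
  by apply: tent_far => l lA; rewrite (dist_sym hd); exact: sep.
have gsv : gs n (emb v) = (\sum_(i in A) a n i) * iota (h n).
  rewrite gsE // -[LHS]/(ev S (a n) (y n) v).
  rewrite (@ev_raise _ _ _ S _ _ (a n) (y n) (fun=> 0) v _ A vE).
  by rewrite /ev big1 ?add0r // => i _; rewrite rmorph0 mulr0.
have h4 : nrm (gs n (emb v)) = nrm (\sum_(i in A) a n i) * h n.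
  by rewrite gsv (sc_nrmM S) (sc_nrm_emb S) gtr0_norm.
by move: h1 h2 h3; rewrite subrK mulr1 h4; lra.
Qed.

(** Were [gam] nonzero at [f], slicing [f] would give sets charged by the combinations on which [f]
    does not vanish; their indices are not tight, and [no_escaping_mass] excludes this. *)
Lemma vanish_near_tight f : lip1 d f -> f x0 = 0 ->
  U (fun n => forall i, tight U d (y ^~ i) -> f (y n i) = 0) -> gam (emb f) = 0.
Proof.
move=> lf f0 fT; apply: (nrm_eq0 S) => e e0; rewrite leNgt; apply/negP => big.
have e20 : 0 < e / 2 by lra.
have [N NP] := nc e20.
have ef0 : iota (f x0) = 0 by rewrite f0 rmorph0.
have Lf := Lip_emb lf f0.
have bign n : (N <= n)%N -> e / 2 < nrm (ev S (a n) (y n) f).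
  move=> Nn; have -> : ev S (a n) (y n) f = gs n (emb f) by rewrite gsE.
  have := NP n Nn _ _ ef0 (lipconst_emb lf); rewrite mulr1 (nrm_distC S) => h.
  by have := sc_nrmD S (gam (emb f) - gs n (emb f)) (gs n (emb f)); rewrite subrK; lra.
have cI : 0 < #|I|%:R :> R by rewrite ltr0n; apply/card_gt0P; exists i0.
pose c := e / 2 / #|I|%:R; have c0 : 0 < c by exact: divr_gt0.
have /choice[F FP] : forall n, exists As : {set I} * R, (N <= n)%N ->
    [/\ 0 < As.2, separated d (y n) As.1 As.2,
        c < nrm (\sum_(i in As.1) a n i) * As.2 &
        forall i, i \in As.1 -> f (y n i) <> 0].
  (* Small [n] get a dummy value, as [U] contains every tail. *)
  move=> n; case: (boolP (N <= n)%N) => Nn; last by exists (finset.set0, 0).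
  have [|A [s [s0 sep cs fi]]] := exists_separated (c := c) hd i0 (suma n) lf
    (ltW c0) (S := S) (y := y n).
    by rewrite -[c *+ _]mulr_natr divfK ?gt_eqF //; exact: bign.
  by exists (A, s) => _; split=> //= i /fi; rewrite yi0 f0.
pose s n := (F n).2; have [A UA] := ultra_const UU (fun n => (F n).1).
have As : U (fun n => [/\ 0 < s n, separated d (y n) A (s n),
     c < nrm (\sum_(i in A) a n i) * s n & forall i, i \in A -> f (y n i) <> 0]).
  by apply: (ultraS UU) (ultraI UU UA (Utail N)) => n [<-]; exact: FP.
have nA i : i \in A -> ~ tight U d (y ^~ i).
  move=> iA ti; have [n [[_ _ _ ne] ft]] := ultra_ex UU (ultraI UU As fT).
  exact: (ne i iA (ft i ti)).
have i0A : i0 \notin A.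
  apply/negP => /nA; apply=> r r0; exists x0; apply: (ultraS UU) (Utail 0) => n _.
  by rewrite yi0 (dist_self hd).
case: (ultra_bounded UU s) => [[D sD]|sinf]; last first.
  apply: (@no_escaping_mass A (fun n => s n / 2) (c / 2)) => //; first by lra.
    apply: (ultraS UU) As => n [sn sep bg _]; split; first by lra.
      by move=> i l iA lA; have := sep i l iA lA; lra.
    by move: bg; rewrite mulrA; lra.
  apply: (unbounded_separation_far (x0 := x0) hd (i0 := i0) (y := y)) => //.
  by apply: (ultraS UU) As => n [].
have D0 : 0 < D.
  by have [n [[sn _ _ _] snD]] := ultra_ex UU (ultraI UU As sD); lra.
have [r r0 escape] := escape_uniform UU d y.
(* The height is capped at the escape radius: when [s n <= r] the bound [c] remains, otherwise the
   mass exceeds [c / D]. *)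
apply: (@no_escaping_mass A (fun n => Num.min (s n) r) (Num.min c (c / D * r))) => //.
- by rewrite lt_min c0 mulr_gt0 ?divr_gt0.
- apply: (ultraS UU) (ultraI UU As sD) => n [[sn sep bg _] snD]; split.
  + by rewrite lt_min sn.
  + by move=> i l iA lA; rewrite ge_min sep.
  + case: (leP (s n) r) => _; first by rewrite ge_min ltW.
    rewrite ge_min; apply/orP; right; rewrite ler_wpM2r ?ltW //.
    rewrite ltr_pdivrMr //; apply: lt_le_trans bg _.
    by rewrite ler_wpM2l ?(nrm_ge0 S).
- move=> p; apply: (ultra_forall UU) => i; case: (boolP (i \in A)) => iA.
    by apply: (ultraS UU) (escape i (nA i iA) p) => n h _; rewrite ge_min h orbT.
  by apply: (ultraS UU) (Utail 0).
Qed.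

(** Soft thresholding makes [f] vanish near the limits and moves it by at most [r] uniformly. The
    change need not be small in Lipschitz norm, so it is measured through a finite combination [psi]
    close to [gam]. *)
Lemma vanish_at_limits f : lip1 d f -> f x0 = 0 ->
  (forall i, tight U d (y ^~ i) -> exists l, f l = 0 /\
     forall e, 0 < e -> U (fun n => d l (y n i) < e)) -> gam (emb f) = 0.
Proof.
move=> lf f0 flim; apply: (nrm_eq0 S) => e e0.
have e30 : 0 < e / 3 by lra.
have [_ /(_ _ e30)[psi [[m [b [q psiE]]] gpsi]]] := Fgam.
pose B := \sum_j nrm (b j).
have B0 : 0 <= B by apply: sumr_ge0 => j _; exact: (nrm_ge0 S).
pose r := e / 3 / (B + 1); have r0 : 0 < r by rewrite divr_gt0 //; lra.
pose g x := Num.max (f x - r) (Num.min (f x + r) 0).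
have lg : lip1 d g.
  apply: lip1_max; first exact: lip1_shift.
  by apply: lip1_min; [exact: lip1_shift|exact: lip1_cst].
have g_eq0 x : `|f x| <= r -> g x = 0.
  by rewrite ler_norml /g => h; rewrite min_r ?max_r //; lra.
have gf x : `|f x - g x| <= r.
  rewrite /g ler_norml; case: (leP (f x + r) 0) => h1;
    rewrite /Num.max; case: ifPn => h2; move: h2; rewrite -?leNgt; lra.
have g0 : g x0 = 0 by apply: g_eq0; rewrite f0 normr0 ltW.
have gg : gam (emb g) = 0.
  apply: vanish_near_tight => //; apply: (ultra_forall UU) => i.
  case: (pselect (tight U d (y ^~ i))) => ti; last by apply: (ultraS UU) (Utail 0).
  have [l [fl near_l]] := flim i ti; apply: (ultraS UU) (near_l r r0) => n h _.
  apply: g_eq0; have := lip1_abs hd (y n i) l lf; rewrite fl subr0 (dist_sym hd).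
  by move=> h'; apply: le_trans h' (ltW h).
have ef0 : iota (f x0) = 0 by rewrite f0 rmorph0.
have eg0 : iota (g x0) = 0 by rewrite g0 rmorph0.
have h1 := gpsi _ _ ef0 (lipconst_emb lf); have h2 := gpsi _ _ eg0 (lipconst_emb lg).
have h3 : nrm (psi (emb f) - psi (emb g)) <= B * r.
  have := ev_le S b (e := r) (y := q) (f := fun x => f x - g x) (fun j => gf (q j)).
  by rewrite evB /ev !psiE //; exact: Lip_emb.
have h4 : B * r <= e / 3.
  have : r * (B + 1) = e / 3 by rewrite divfK // gt_eqF //; lra.
  by rewrite mulrDr mulr1 mulrC; lra.
have := sc_nrmD S (gam (emb f) - psi (emb f)) (psi (emb f)); rewrite subrK.
have := sc_nrmD S (psi (emb f) - psi (emb g)) (psi (emb g)); rewrite subrK.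
by move: h1 h2; rewrite gg sub0r (nrmN S) !mulr1; lra.
Qed.

(** Real and imaginary parts are rescaled to be 1-Lipschitz; [L + 1] avoids a division by 0. *)
Lemma vanish_at_limits_scalar g : Lip g ->
  (forall i, tight U d (y ^~ i) -> exists l, g l = 0 /\
     forall e, 0 < e -> U (fun n => d l (y n i) < e)) -> gam g = 0.
Proof.
move=> Lg glim; have [g0 [L gL]] := Lg; have L0 := gL.1.
have [[lin _] _] := Fgam.
have L1 : 0 < L + 1 by lra.
pose z : M -> R := fun=> 0.
have lz : lip1 d z by exact: lip1_cst.
have gz : gam (emb z) = 0.
  by apply: vanish_at_limits => // i /glim[l [_ h]]; exists l.
have rpart f : (forall x y, `|f x - f y| <= L * d x y) -> f x0 = 0 ->
    (forall x, g x = 0 -> f x = 0) -> Lip (emb f) /\ gam (emb f) = 0.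
  move=> fL f0 fg; pose f' x := f x / (L + 1).
  have lf' : lip1 d f'.
    apply: lip1_div => // x w; apply: le_trans (fL x w) _.
    by rewrite ler_wpM2r ?dist_ge0 //; lra.
  have f'0 : f' x0 = 0 by rewrite /f' f0 mul0r.
  have gf' : gam (emb f') = 0.
    apply: vanish_at_limits => // i /glim[l [gl h]]; exists l.
    by rewrite /f' fg ?mul0r.
  have fE : emb f = fun x => iota (L + 1) * iota (f' x) + iota (z x).
    by apply: funext => x; rewrite -rmorphM -rmorphD /f' mulrC divfK ?gt_eqF ?addr0.
  split; first by rewrite fE; apply: Lip_comb; exact: Lip_emb.
  by rewrite fE lin ?gf' ?gz ?mulr0 ?addr0 //; exact: Lip_emb.
have re0 : sc_re S 0 = 0.
  by apply/eqP; rewrite -normr_le0 -(nrm0 S); exact: sc_re_le.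
have im0 : sc_im S 0 = 0.
  by apply/eqP; rewrite -normr_le0 -(nrm0 S); exact: sc_im_le.
have [|x ->//|Lr gr] := rpart _ (lipconst_re gL); first by rewrite g0.
have [|x ->//|Li gi] := rpart _ (lipconst_im gL); first by rewrite g0.
have -> : g = fun x => sc_unit S * iota (sc_im S (g x)) + iota (sc_re S (g x)).
  by apply: funext => x; rewrite -sc_decomp.
by rewrite lin // gr gi mulr0 addr0.
Qed.

End Closed.
End Convergence.

Lemma weak_limit_FS k gs gam : complete_metric d ->
  (forall n, in_FS nrm d x0 k (gs n)) -> in_Free nrm d x0 gam ->
  weak_cvg nrm d x0 gs gam ->
  in_FS nrm d x0 k gam /\ norm_cvg nrm d x0 gs gam.
Proof.
move=> hc FS Fgam wc.
have /choice[ay ayP] := fun n => in_FS_total0 (FS n).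
pose a n := (ay n).1; pose y n := (ay n).2.
have suma n : \sum_i a n i = 0 by case: (ayP n).
have yi0 n : y n ord0 = x0 by case: (ayP n).
have gsE n g : Lip g -> gs n g = \sum_i a n i * g (y n i).
  by case: (ayP n) => _ _; apply.
have nc := weak_norm_cvg suma yi0 gsE wc; split=> //.
have [U [UU Utail]] := exists_ultrafilter.
have /choice[P PP] : forall i, exists l, tight U d (y ^~ i) ->
    forall e, 0 < e -> U (fun n => d l (y n i) < e).
  (* Escaping indices impose no condition; [x0] is a dummy witness. *)
  move=> i; case: (pselect (tight U d (y ^~ i))) => ti; last by exists x0.
  by have [l h] := tight_limit hd hc UU ti; exists l.
have [lin _] := Fgam.1.
(* The shift by one skips [ord0], the base point, where functions in [Lip0] vanish; this leaves [k]
   points rather than [k.+1]. *)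
have [f Lf fP|b bP] := @span_of_kernel (fun j => P (inord j.+1)) k gam lin.
  apply: (vanish_at_limits_scalar suma yi0 gsE nc Fgam UU Utail Lf) => i ti.
  case: (unliftP ord0 i) => [j|] ei; last first.
    exists x0; split; first by case: Lf.
    move=> e e0; apply: (ultraS UU) (Utail 0) => n _.
    by rewrite ei yi0 (dist_self hd).
  exists (P i); split; last exact: PP.
  by have := fP j (ltn_ord j); rewrite -[j.+1]/(lift ord0 j : nat) inord_val -ei.
by exists (fun i => b i), (fun i => P (inord i.+1)) => f Lf; rewrite bP.
Qed.

End FreeSpace.

(** * The real and the complex scalars *)

Definition real_scalars (R : realType) : scalars (@Num.norm R R).
Proof.
refine (@Scalars R R _ idfun 0 id (fun=> 0) _ _ _ _ _ _ _ _ _) => //=.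
- exact: normrM.
- exact: ler_normD.
- by rewrite normr0.
- by move=> x; rewrite mul0r add0r.
- by move=> _ _; rewrite subrr.
- by move=> x; rewrite normr0.
Defined.

Definition complex_scalars (R : realType) : scalars (@cmod R).
Proof.
refine (@Scalars R R[i] _ (real_complex R) 'i%C (@complex.Re R) (@complex.Im R)
  _ _ _ _ _ _ _ _ _).
- exact: Normc.normcM.
- exact: le_normcD.
- by move=> r; rewrite /cmod /= expr0n addr0 sqrtr_sqr.
- by rewrite /cmod /= expr0n add0r expr1n sqrtr1.
- by move=> [u v]; apply/eqP; rewrite eq_complex /=; apply/andP; split; apply/eqP; ring.
- by move=> [u v] [w z].
- by move=> [u v] [w z].
- by move=> [u v]; rewrite /cmod /= -sqrtr_sqr ler_wsqrtr // lerDl sqr_ge0.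
- by move=> [u v]; rewrite /cmod /= -sqrtr_sqr ler_wsqrtr // lerDr sqr_ge0.
Defined.

(* Conjunction of the real-scalar case (K = R, |.|) and the complex-scalar
   case (K = R[i], modulus). *)
Theorem theoremC (R : realType) (M : Type) (d : M -> M -> R) (x0 : M)
  (hd : is_metric d) (hc : complete_metric d) (k : nat) :
  (forall (gs : nat -> (M -> R) -> R) (gam : (M -> R) -> R),
     (forall n, in_FS (@Num.norm R R) d x0 k (gs n)) ->
     in_Free (@Num.norm R R) d x0 gam ->
     weak_cvg (@Num.norm R R) d x0 gs gam ->
     in_FS (@Num.norm R R) d x0 k gam /\ norm_cvg (@Num.norm R R) d x0 gs gam) /\
  (forall (gs : nat -> (M -> R[i]) -> R[i]) (gam : (M -> R[i]) -> R[i]),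
     (forall n, in_FS (@cmod R) d x0 k (gs n)) ->
     in_Free (@cmod R) d x0 gam ->
     weak_cvg (@cmod R) d x0 gs gam ->
     in_FS (@cmod R) d x0 k gam /\ norm_cvg (@cmod R) d x0 gs gam).
Proof.
split=> gs gam.
- by move=> *; apply: (weak_limit_FS (real_scalars R)).
- by move=> *; apply: (weak_limit_FS (complex_scalars R)).
Qed.
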